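(* Let $r\geq1$. For $x\geq1$, \[ \sum_{\substack{n_1,\ldots,n_r\geq1\\ n_1>x}}\frac{1}{\varphi([n_1,n_2,\ldots,n_r])\,n_1n_2\cdots n_r}=O\!\left(\frac{1}{x}\right), \] where the sum runs over all $r$-tuples $(n_1,\ldots,n_r)$ of positive integers with $n_1>x$.
   Context: $\varphi$ is Euler's totient function and $[n_1,\ldots,n_r]$ denotes the least common multiple. The implied constant may depend on $r$. *)

(* Defs.v *)
From mathcomp Require Export all_boot all_order all_algebra.
From mathcomp Require Export all_classical all_reals all_analysis.

Set Implicit Arguments.
Unset Strict Implicit.
Unset Printing Implicit Defensive.

Import Order.TTheory GRing.Theory Num.Theory.

Local Open Scope classical_set_scope.
Local Open Scope ring_scope.

Definition lcm_fam (r : nat) (n : {ffun 'I_r -> nat}) : nat :=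
  \big[lcmn/1%N]_(i < r) n i.

Definition summand (R : realType) (r : nat) (n : {ffun 'I_r -> nat}) : R :=
  ((totient (lcm_fam n))%:R * \prod_(i < r) (n i)%:R)^-1.

(* The entry n_1 of the r-tuple is the value at index 0 < r. *)
Definition tail_tuples (R : realType) (r : nat) (hr : (0 < r)%N) (x : R) :
    set {ffun 'I_r -> nat} :=
  [set n | (forall i, (0 < n i)%N) /\ x < (n (Ordinal hr))%:R].

(* Main.v *)
Require Import Defs.
From mathcomp Require Import all_boot all_order all_algebra.
From mathcomp Require Import all_classical all_reals all_analysis.
From mathcomp Require Import cyclic finmap zify ring lra.

(** Write m = n_1 and N = [n_2, ..., n_r]. From phi(m) phi(N) <= (m, N) phi([m, N])
    and (m, N) = sum of phi(d) over the common divisors d, the sum over m > x is at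
    most 1 / phi(N) times the sum over d | N of
      phi(d) * sum_(m > x, d | m) 1 / (m phi(m)) = O(1 / x),
    uniformly in d. This last bound follows from phi(d j) >= phi(d) phi(j) and
    k / phi(k) <= sum_(d | k) 1 / phi(d). It remains to sum tau(N) / (phi(N) n_2 ... n_r):
    tau(N)^2 <= 4 N and N^2 <= 64 phi(N)^3 give tau(N) / phi(N) <= 8 N^(-1/6), and since
    N >= n_i for every i this is at most 8 times the product of n_i^(-1/(6 r)), so
    the sum is dominated by a product of convergent series. Partial sums over finite
    boxes suffice because all terms are nonnegative. *)

Set Implicit Arguments.
Unset Strict Implicit.
Unset Printing Implicit Defensive.

Import Order.TTheory GRing.Theory Num.Theory.

Local Open Scope classical_set_scope.
Local Open Scope ring_scope.

(** * Inequalities for the totient function *)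

Lemma nat_prime_ind (P : nat -> Prop) : P 1%N ->
  (forall p m, prime p -> (0 < m)%N -> P m -> P (p * m)%N) ->
  forall n, (0 < n)%N -> P n.
Proof.
move=> P1 PM; elim/ltn_ind => n IH n_gt0.
have [n_gt1|] := ltnP 1 n; last by case: n n_gt0 {IH} => [|[]].
have [p p_pr /dvdnP[m nE]] := pdivP n_gt1.
rewrite nE mulnC in n_gt0 *; move: n_gt0; rewrite muln_gt0 => /andP[p0 m0].
apply: PM => //; apply: IH => //.
by rewrite nE ltn_Pmulr// prime_gt1.
Qed.

(** If p divides m, isolating the power of p in m shows that one more factor p multiplies the
    totient by p. With [nat_prime_ind], this turns totient inequalities into comparisons of one
    prime factor at a time. *)
Lemma totient_prime_mul (p m : nat) : prime p -> (0 < m)%N ->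
  totient (p * m) = ((if (p %| m)%N then p else p.-1) * totient m)%N.
Proof.
move=> p_pr m_gt0; case: ifPn => [pm|npm]; last first.
  by rewrite totient_coprime ?prime_coprime// totient_prime.
have [u npu mE] := pfactor_coprime p_pr m_gt0.
have : (0 < logn p m)%N by rewrite logn_gt0 mem_primes p_pr m_gt0.
case: (logn p m) mE => // k -> _.
have cu e : coprime u (p ^ e) by rewrite coprimeXr// coprime_sym.
rewrite mulnCA -expnS !(totient_coprime (cu _)) !totient_pfactor// !succnK expnS.
ring.
Qed.

(** Adjoining a prime p to a = p m multiplies the left side by p only if p divides m. Then p also
    divides m b, so the right side gains p as well. Otherwise the left gains p - 1 and the right at
    least that. *)
Lemma totient_supermul (a b : nat) : (0 < a)%N -> (0 < b)%N ->
  (totient a * totient b <= totient (a * b))%N.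
Proof.
move=> a_gt0 b_gt0; elim/nat_prime_ind: a / a_gt0 => [|p m p_pr m0 IH].
  by rewrite mul1n [totient 1]/= mul1n.
rewrite -mulnA !(totient_prime_mul p_pr) ?muln_gt0 ?m0// -mulnA leq_mul//.
have [pm|] := boolP (p %| m)%N; first by rewrite dvdn_mulr.
by case: ifP => // _ _; apply: leq_pred.
Qed.

Lemma totient_mul_le (a b : nat) : (0 < a)%N -> (0 < b)%N ->
  (totient (a * b) <= a * totient b)%N.
Proof.
move=> a_gt0 b_gt0; elim/nat_prime_ind: a / a_gt0 => [|p m p_pr m0 IH].
  by rewrite !mul1n.
rewrite -!mulnA (totient_prime_mul p_pr) ?muln_gt0 ?m0// leq_mul//.
by case: ifP => // _; apply: leq_pred.
Qed.

Lemma totient_mul_le_gcd_lcm (a b : nat) : (0 < a)%N -> (0 < b)%N ->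
  (totient a * totient b <= gcdn a b * totient (lcmn a b))%N.
Proof.
move=> a0 b0; apply: leq_trans (totient_supermul a0 b0) _.
by rewrite -muln_lcm_gcd mulnC totient_mul_le// ?gcdn_gt0 ?lcmn_gt0 ?a0.
Qed.

Lemma totient_pow_ge (p a : nat) : prime p -> (p ^ a <= 2 * totient (p ^ a))%N.
Proof.
move=> p_pr; case: a => [|a]; first by rewrite expn0.
by rewrite totient_pfactor// succnK expnS mulnA leq_mul2r; have := prime_gt1 p_pr; lia.
Qed.

Lemma totient_cube_ge_coprime6 (n : nat) : (0 < n)%N -> coprime 6 n ->
  (n ^ 2 <= totient n ^ 3)%N.
Proof.
move=> n_gt0; elim/nat_prime_ind: n / n_gt0 => // p m p_pr m0 IH.
rewrite coprimeMr => /andP[cp /IH{}IH].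
have p4 : (4 <= p)%N by case: p p_pr cp => [|[|[|[|]]]].
(* This fails for p = 2 and p = 3, which is why n is taken coprime to 6. *)
have pcube : (p ^ 2 <= p.-1 ^ 3)%N.
  by case: p p4 {p_pr cp} => // q /= q3; rewrite !expnS !expn0; nia.
rewrite totient_prime_mul// !expnMn leq_mul//.
by apply: leq_trans pcube _; rewrite leq_exp2r//; case: ifP => // _; apply: leq_pred.
Qed.

(** Write n = 2^a 3^b v with v coprime to 6. Each of the two prime powers q satisfies q^2 <= q^3 <=
    (2 phi(q))^3, so each costs a factor 8, whence 64. *)
Lemma totient_cube_ge (n : nat) : (0 < n)%N -> (n ^ 2 <= 64 * totient n ^ 3)%N.
Proof.
move=> n0; have [u cu] := pfactor_coprime (isT : prime 2) n0.
move: (logn 2 n) => a nE.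
have u0 : (0 < u)%N by move: n0; rewrite nE muln_gt0 => /andP[].
have [v cv] := pfactor_coprime (isT : prime 3) u0.
move: (logn 3 u) => b uE.
have v0 : (0 < v)%N by move: u0; rewrite uE muln_gt0 => /andP[].
have c2v : coprime 2 v by move: cu; rewrite uE coprimeMr => /andP[].
have v6 : coprime 6 v by rewrite (_ : 6 = 2 * 3)%N// coprimeMl c2v.
have := totient_cube_ge_coprime6 v0 v6.
have := totient_pow_ge a (isT : prime 2).
have := totient_pow_ge b (isT : prime 3).
rewrite nE totient_coprime; last by rewrite coprime_sym coprimeXl.
rewrite uE totient_coprime; last by rewrite coprime_sym coprimeXl.
have : (0 < 2 ^ a)%N by rewrite expn_gt0.
have : (0 < 3 ^ b)%N by rewrite expn_gt0.
move: (totient v) (totient (3 ^ b)) (totient (2 ^ a)) => f g h.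
move: (2 ^ a)%N (3 ^ b)%N => {nE uE}a {}b b0 a0 gb ha vf.
rewrite !expnMn (_ : 64 = 2 ^ 3 * 2 ^ 3)%N//.
have gb3 : (b ^ 2 <= 2 ^ 3 * g ^ 3)%N.
  by rewrite -expnMn; apply: leq_trans (_ : b ^ 3 <= _)%N; rewrite ?leq_pexp2l ?leq_exp2r.
have ha3 : (a ^ 2 <= 2 ^ 3 * h ^ 3)%N.
  by rewrite -expnMn; apply: leq_trans (_ : a ^ 3 <= _)%N; rewrite ?leq_pexp2l ?leq_exp2r.
apply: leq_trans (leq_mul (leq_mul vf gb3) ha3) _.
by rewrite (_ : _ * _ = 2 ^ 3 * 2 ^ 3 * (f ^ 3 * g ^ 3 * h ^ 3))%N //; ring.
Qed.

(** * Counting divisors *)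

Lemma size_sq_le (n : nat) (s : seq nat) : uniq s ->
  (forall d, d \in s -> (0 < d)%N /\ (d ^ 2 <= n)%N) -> (size s ^ 2 <= n)%N.
Proof.
move=> us hs; rewrite leqNgt; apply/negP => ns.
suff : (size s <= size (iota 1 (size s).-1))%N.
  by rewrite size_iota; case: (size s) ns => // k _; rewrite ltnn.
apply: uniq_leq_size => // d /hs[d0 dn]; rewrite mem_iota d0 /=.
have := leq_ltn_trans dn ns; rewrite ltn_exp2r// => ds.
by rewrite add1n prednK// (leq_ltn_trans _ ds).
Qed.

(** The divisors d with d^2 <= n, and the cofactors n / d of the others, are two families of
    distinct positive integers with square at most n. If they have sizes a and b, then (a + b)^2 <=
    2 (a^2 + b^2) <= 4 n. *)
Lemma size_divisors_sq_le (n : nat) : (0 < n)%N -> (size (divisors n) ^ 2 <= 4 * n)%N.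
Proof.
move=> n0; pose P d := (d ^ 2 <= n)%N.
have dvd d : d \in divisors n -> (d %| n)%N by rewrite dvdn_divisors.
have h1 : (size (seq.filter P (divisors n)) ^ 2 <= n)%N.
  apply: size_sq_le; first by rewrite filter_uniq// divisors_uniq.
  by move=> d; rewrite mem_filter => /andP[dP /dvd dn]; rewrite (dvdn_gt0 n0).
have h2 : (size (seq.filter (predC P) (divisors n)) ^ 2 <= n)%N.
  rewrite -(size_map (divn n)); apply: size_sq_le.
    rewrite map_inj_in_uniq ?filter_uniq ?divisors_uniq// => d e.
    rewrite !mem_filter => /andP[_ /dvd dn] /andP[_ /dvd en] de.
    have e0 : (0 < n %/ e)%N by rewrite divn_gt0 (dvdn_leq n0 en, dvdn_gt0 n0 en).
    apply/eqP; rewrite -(eqn_pmul2l e0); apply/eqP.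
    by rewrite -{1}de (divnK dn) (divnK en).
  move=> e /mapP[d]; rewrite mem_filter => /andP[/= dP /dvd dn] -> {e}.
  have d0 := dvdn_gt0 n0 dn; split; first by rewrite divn_gt0 ?(dvdn_leq n0 dn).
  move: dP; rewrite /P -ltnNge -{1 3}(divnK dn) => dP.
  move: (n %/ d)%N dP => q dP; rewrite -mulnn leq_mul2l; apply/orP; right.
  by move: dP; rewrite -mulnn ltn_pmul2r// => /ltnW.
rewrite !size_filter in h1 h2; rewrite -(count_predC P).
rewrite sqrnD; have := (nat_Cauchy (count P (divisors n)) (count (predC P) (divisors n))).1.
by move: (2 * _)%N (_ ^ 2)%N (_ ^ 2)%N h1 h2 => c a b; lia.
Qed.

(** * Comparison of finite sums, and the ratio n / phi(n) *)

(** Terms are matched along [h], and the unmatched terms of [t] are dropped by nonnegativity. This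
    serves for inclusions of divisor lists, for dividing multiples by d, and for embedding a finite
    set of tuples into a box. *)
Lemma ler_sum_inj (R : numDomainType) (I J : eqType) (s : seq I) (t : seq J)
    (h : I -> J) (F : I -> R) (G : J -> R) :
  uniq s -> uniq t -> {in s &, injective h} -> {in s, forall i, h i \in t} ->
  {in s, forall i, F i <= G (h i)} -> {in t, forall j, 0 <= G j} ->
  \sum_(i <- s) F i <= \sum_(j <- t) G j.
Proof.
elim: s t => [|i s IH] t /=.
  by move=> _ _ _ _ _ G0; rewrite big_nil big_seq sumr_ge0.
move=> /andP[is_ us] ut hinj ht hF G0.
have hit : h i \in t by apply: ht; rewrite mem_head.
rewrite big_cons (perm_big _ (perm_to_rem hit)) big_cons lerD ?hF ?mem_head//.
have sub k : k \in s -> k \in i :: s by move=> ks; rewrite inE ks orbT.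
apply: IH => //.
- exact: rem_uniq.
- by move=> k l ks ls; apply: hinj; apply: sub.
- move=> k ks; rewrite mem_rem_uniq// inE ht ?sub// andbT.
  apply: contraNneq is_ => hk; rewrite -(hinj _ _ _ _ hk) ?mem_head ?sub//.
- by move=> k ks; apply: hF; apply: sub.
- by move=> j /mem_rem; apply: G0.
Qed.

(** Induction on prime factors. If p divides m, the ratio is unchanged and the divisors only
    increase. Otherwise the ratio gains p / (p - 1) = 1 + 1 / (p - 1), and the two terms account for
    the divisors d and p d with d | m. *)
Lemma totient_ratio_le_sum_inv (R : numFieldType) (n : nat) : (0 < n)%N ->
  n%:R / (totient n)%:R <= \sum_(d <- divisors n) ((totient d)%:R)^-1 :> R.
Proof.
move=> n0; elim/nat_prime_ind: n / n0 => [|p m p_pr m0 IH].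
  by rewrite (_ : divisors 1 = [:: 1%N])// big_seq1 /= divr1 invr1.
have p_gt1 := prime_gt1 p_pr; have p0 := prime_gt0 p_pr.
have pm0 : (0 < p * m)%N by rewrite muln_gt0 p0.
rewrite totient_prime_mul//; case: ifPn => [pm|npm].
  rewrite !natrM -mulf_div divff ?mul1r ?pnatr_eq0 -?lt0n//.
  apply: le_trans IH _; apply: (ler_sum_inj (h := id)); rewrite ?divisors_uniq//.
  by move=> d; rewrite -!dvdn_divisors// => dm; apply: dvdn_mull.
rewrite !natrM -mulf_div.
have p1 : p%:R / p.-1%:R = 1 + p.-1%:R^-1 :> R.
  have : p.-1%:R != 0 :> R by rewrite pnatr_eq0; case: p p_gt1 {p_pr p0 pm0 npm} => [|[]].
  by rewrite -{2}(prednK p0) -natr1 => h; rewrite mulrDl divff// mul1r.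
apply: le_trans (_ : _ <= (p%:R / p.-1%:R) * \sum_(d <- divisors m) (totient d)%:R^-1) _.
  by rewrite ler_wpM2l// divr_ge0 ?ler0n.
rewrite p1 mulrDl mul1r mulr_sumr.
rewrite (_ : \sum_(i <- divisors m) _ * _ =
    \sum_(i <- [seq (p * d)%N | d <- divisors m]) (totient i)%:R^-1); last first.
  rewrite big_map big_seq [RHS]big_seq; apply: eq_bigr => d.
  rewrite -dvdn_divisors// => dm; rewrite totient_prime_mul// ?(dvdn_gt0 m0)//.
  by rewrite ifN ?natrM ?invfM//; apply: contra npm => /dvdn_trans; apply.
rewrite -big_cat; apply: (ler_sum_inj (h := id)) => //; rewrite ?divisors_uniq//.
- rewrite cat_uniq divisors_uniq /= map_inj_uniq ?divisors_uniq ?andbT; last first.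
    by move=> a b /eqP; rewrite eqn_pmul2l// => /eqP.
  apply/hasPn => _ /mapP[d _ ->]; rewrite -dvdn_divisors//.
  by apply: contra npm => h; apply: dvdn_trans h; apply: dvdn_mulr.
- move=> d; rewrite mem_cat => /orP[|/mapP[e + ->]]; rewrite -!dvdn_divisors//.
    by move=> dm; apply: dvdn_mull.
  by move=> em; apply: dvdn_mul.
Qed.

(** * Sums of n^(-1-1/k) and tails of the sum of n^(-2) *)

(** With the reciprocal of an integer as exponent, bounds can be checked after raising to an integer
    power. *)
Definition invroot (R : realType) (k n : nat) : R := n%:R `^ (- k%:R^-1).

Lemma invroot_gt0 (R : realType) (k n : nat) : (0 < n)%N -> 0 < invroot R k n.
Proof. by move=> n0; rewrite powR_gt0// ltr0n. Qed.

Lemma invroot_expr (R : realType) (k n : nat) : (0 < k)%N -> (0 < n)%N ->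
  invroot R k n ^+ k = n%:R^-1.
Proof.
move=> k0 n0; rewrite -powR_mulrn ?powR_ge0// /invroot -powRrM mulNr mulVf.
  by rewrite powR_inv1.
by rewrite pnatr_eq0 -lt0n.
Qed.

Lemma invroot_le (R : realType) (k m n : nat) : (0 < m)%N -> (m <= n)%N ->
  invroot R k n <= invroot R k m.
Proof.
move=> m0 mn; rewrite /invroot !powRN lef_pV2 ?posrE ?powR_gt0 ?ltr0n//.
  by rewrite ge0_ler_powR ?invr_ge0 ?nnegrE ?ler_nat.
exact: leq_trans mn.
Qed.

Lemma invroot_le1 (R : realType) (k n : nat) : (0 < n)%N -> invroot R k n <= 1.
Proof.
by move=> n0; have := invroot_le R k (ltn0Sn 0) n0; rewrite [in leRHS]/invroot powR1.
Qed.

(* Write a and b for the k-th roots of 1/n and 1/(n+1): the factorisation of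
   a ^ k - b ^ k gives 1 / (n (n + 1)) <= (a - b) k a ^ (k - 1). *)
Lemma invroot_telescope (R : realType) (k n : nat) : (0 < k)%N -> (0 < n)%N ->
  n%:R^-1 * invroot R k n <= 2 * k%:R * (invroot R k n - invroot R k n.+1).
Proof.
move=> k0 n0; set a := invroot R k n; set b := invroot R k n.+1.
have a0 : 0 < a by apply: invroot_gt0.
have b0 : 0 < b by apply: invroot_gt0.
have ba : b <= a by apply: invroot_le.
have N0 : 0 < n%:R :> R by rewrite ltr0n.
have ak : a ^+ k = n%:R^-1 by apply: invroot_expr.
have bk : b ^+ k = n.+1%:R^-1 by apply: invroot_expr.
have h : n%:R^-1 - n.+1%:R^-1 <= (a - b) * (k%:R * a ^+ k.-1).
  rewrite -ak -bk subrXX ler_wpM2l ?subr_ge0//.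
  rewrite [leRHS](_ : _ = \sum_(i < k) a ^+ k.-1); last first.
    by rewrite sumr_const card_ord mulr_natl.
  apply: ler_sum => i _.
  rewrite [leRHS](_ : _ = a ^+ (k.-1 - i) * a ^+ i); last first.
    by rewrite -exprD subnK// -ltnS prednK.
  by rewrite ler_wpM2l ?exprn_ge0 ?(ltW a0)// lerXn2r ?nnegrE ?(ltW a0) ?(ltW b0).
have {}h : (n%:R^-1 - n.+1%:R^-1) * a <= (a - b) * (k%:R * n%:R^-1).
  apply: le_trans (ler_wpM2r (ltW a0) h) _.
  by rewrite -ak (_ : a ^+ k = a ^+ k.-1 * a) ?mulrA// -exprSr prednK.
have {}h : a / n.+1%:R <= (a - b) * k%:R.
  rewrite -(ler_pM2r (_ : 0 < n%:R^-1)) ?invr_gt0// -[leRHS]mulrA.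
  apply: le_trans h; rewrite le_eqVlt; apply/orP; left; apply/eqP.
  rewrite -natr1; field; apply/andP; split; lra.
have : n%:R^-1 * a <= 2 * (a / n.+1%:R).
  rewrite mulrA mulrAC ler_pM2r// ler_pdivlMr ?ltr0n// mulrC ler_pdivrMr//.
  rewrite -natr1; have : 1 <= n%:R :> R by rewrite ler1n.
  lra.
by move/le_trans; apply; rewrite -mulrA ler_pM2l// [leRHS]mulrC.
Qed.

Lemma sum_invroot_le (R : realType) (k M : nat) : (0 < k)%N ->
  \sum_(1 <= n < M.+1) n%:R^-1 * invroot R k n <= 2 * k%:R.
Proof.
move=> k0.
apply: le_trans (_ : _ <= \sum_(1 <= n < M.+1) 2 * k%:R * (invroot R k n - invroot R k n.+1)) _.
  by apply: ler_sum_nat => n /andP[n0 _]; apply: invroot_telescope.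
rewrite -mulr_sumr -[leRHS]mulr1 ler_wpM2l ?mulr_ge0 ?ler0n//.
have := telescope_sumr (fun n => - invroot R k n) (isT : 1 <= M.+1)%N.
under eq_bigr do rewrite opprK addrC.
move=> ->; rewrite opprK addrC lerBlDr.
by rewrite ler_wpDr ?invroot_le1// ltW ?invroot_gt0.
Qed.

Lemma sum_sqr_tail_le (R : realFieldType) (M : nat) (y : R) : 0 < y ->
  \sum_(1 <= n < M.+1 | y < n%:R) (n%:R ^+ 2)^-1 <= 2 / y.
Proof.
(* Capping 1 / n at 1 / y gives a nonincreasing sequence bounded by 1 / y, so the telescoping sum
   can run over all n, including those with n <= y. *)
move=> y0; pose b (n : nat) : R := Num.min y^-1 n%:R^-1.
have b_le n : b n <= y^-1 by rewrite ge_min lexx.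
have b_ge0 n : 0 <= b n by rewrite le_min !invr_ge0 ler0n ltW.
rewrite big_mkcond.
apply: le_trans (_ : _ <= \sum_(1 <= n < M.+1) 2 * (b n - b n.+1)) _.
  apply: ler_sum_nat => n /andP[n0 _].
  have N0 : 0 < n%:R :> R by rewrite ltr0n.
  case: ifP => [yn|_]; last first.
    rewrite mulr_ge0// subr_ge0 /b le_min !ge_min lexx /=.
    by rewrite [X in _ || X]lef_pV2 ?posrE ?ltr0n// ler_nat leqnSn orbT.
  have yn1 : y < n.+1%:R by rewrite -natr1; lra.
  rewrite /b !min_r ?lef_pV2 ?posrE ?ltr0n// ?(ltW yn) ?(ltW yn1)//.
  rewrite -natr1; have n1 : 1 <= n%:R :> R by rewrite ler1n.
  rewrite [leRHS](_ : _ = 2 / (n%:R * (n%:R + 1))); last by field; apply/andP; split; lra.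
  rewrite ler_pdivlMr; last by apply: mulr_gt0; lra.
  rewrite mulrC ler_pdivrMr ?exprn_gt0//; nra.
rewrite -mulr_sumr ler_wpM2l//.
have := telescope_sumr (fun n => - b n) (isT : 1 <= M.+1)%N.
under eq_bigr do rewrite opprK addrC.
move=> ->; rewrite opprK addrC lerBlDr.
by rewrite ler_wpDr.
Qed.

(** * Divisor sums and the sum over the first variable *)

Lemma big_divisors (R : nmodType) (s : seq nat) (k : nat) (F : nat -> R) :
  (0 < k)%N -> uniq s -> {subset divisors k <= s} ->
  \sum_(d <- divisors k) F d = \sum_(d <- s | (d %| k)%N) F d.
Proof.
move=> k0 us ks; rewrite -[RHS]big_filter; apply/perm_big/uniq_perm.
- exact: divisors_uniq.
- exact: filter_uniq.
- move=> d; rewrite mem_filter dvdn_divisors//.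
  by case: (boolP (d \in divisors k)) => //= /ks ->.
Qed.

(** Gauss's identity for the gcd, indexed by the divisors of n so that the index range does not
    depend on m and the sums can be exchanged. *)
Lemma gcdn_sum_totient (R : pzSemiRingType) (m n : nat) : (0 < n)%N ->
  (gcdn m n)%:R = \sum_(d <- divisors n | (d %| gcdn m n)%N) (totient d)%:R :> R.
Proof.
move=> n0; have g0 : (0 < gcdn m n)%N by rewrite gcdn_gt0 n0 orbT.
rewrite -big_divisors ?divisors_uniq//; last first.
  by move=> d; rewrite -!dvdn_divisors// => /dvdn_trans; apply; apply: dvdn_gcdr.
rewrite (@big_divisors _ (index_iota 0 (gcdn m n).+1)) ?iota_uniq//; last first.
  by move=> d; rewrite -dvdn_divisors// mem_index_iota /= => /(dvdn_leq g0).
by rewrite big_mkord -natr_sum sum_totient_dvd.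
Qed.

Lemma ler_sum_multiples (R : numDomainType) (M d : nat) (P : pred nat)
    (G : nat -> R) : (0 < d)%N -> (forall n, 0 <= G n) ->
  \sum_(1 <= m < M | P m && (d %| m)%N) G m <=
  \sum_(1 <= j < M | P (d * j)%N) G (d * j)%N.
Proof.
move=> d0 G0; rewrite -big_filter -[leRHS]big_filter.
apply: (ler_sum_inj (h := divn ^~ d)).
- by rewrite filter_uniq// iota_uniq.
- by rewrite filter_uniq// iota_uniq.
- move=> m n; rewrite !mem_filter => /andP[/andP[_ dm] _] /andP[/andP[_ dn] _] mn.
  by rewrite -(divnK dm) mn divnK.
- move=> m; rewrite !mem_filter !mem_index_iota => /andP[/andP[Pm dm] /andP[m0 mM]].
  rewrite mulnC divnK// Pm divn_gt0// (dvdn_leq m0 dm)/=.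
  exact: leq_ltn_trans (leq_div _ _) mM.
- by move=> m; rewrite mem_filter => /andP[/andP[_ dm] _]; rewrite mulnC divnK.
- by [].
Qed.

(** After cubing, n <= n^2 <= 64 phi(n)^3 is enough. The exponent 1/3 is weaker than the 2/3
    available, but it still makes the sum of 1 / (d phi(d)) converge. *)
Lemma inv_totient_le (R : realType) (n : nat) : (0 < n)%N ->
  (totient n)%:R^-1 <= 4 * invroot R 3 n.
Proof.
move=> n0; have t0 : (0 < totient n)%N by rewrite totient_gt0.
rewrite -(ler_pXn2r (isT : 0 < 3)%N) ?nnegrE ?invr_ge0 ?mulr_ge0 ?powR_ge0//.
rewrite exprMn invroot_expr// exprVn ler_pdivlMr ?ltr0n// mulrC.
rewrite ler_pdivrMr ?exprn_gt0 ?ltr0n// -!natrX -natrM ler_nat.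
by apply: leq_trans (totient_cube_ge n0); rewrite -mulnn leq_pmull.
Qed.

Lemma sum_inv_mul_totient_tail (R : realType) (M : nat) (y : R) : 0 < y ->
  \sum_(1 <= k < M.+1 | y < k%:R) (k%:R * (totient k)%:R)^-1 <= 48 / y.
Proof.
move=> y0.
apply: le_trans (_ : _ <= \sum_(1 <= k < M.+1 | y < k%:R)
   \sum_(1 <= d < M.+1 | (d %| k)%N) (totient d)%:R^-1 * (k%:R ^+ 2)^-1) _.
  rewrite big_nat_cond [leRHS]big_nat_cond; apply: ler_sum => k /andP[/andP[k0 kM] _].
  rewrite -mulr_suml -big_divisors ?iota_uniq//; last first.
    move=> d; rewrite -dvdn_divisors// mem_index_iota => dk.
    by rewrite (dvdn_gt0 k0 dk) ltnS (leq_trans (dvdn_leq k0 dk)).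
  rewrite ler_pdivlMr ?exprn_gt0 ?ltr0n//.
  apply: le_trans (totient_ratio_le_sum_inv R k0).
  have tk0 : (totient k)%:R != 0 :> R by rewrite pnatr_eq0 -lt0n totient_gt0.
  have kk0 : k%:R != 0 :> R by rewrite pnatr_eq0 -lt0n.
  by rewrite le_eqVlt; apply/orP; left; apply/eqP; field; rewrite tk0.
rewrite (exchange_big_dep xpredT)//=.
(* The multiples k > y of d contribute at most 2 / (y d) to the sum of k^(-2), and 1 / phi(d) brings
   the factor 4. The remaining sum over d is at most 2 * 3, so the total is 48 / y. *)
apply: le_trans (_ : _ <= \sum_(1 <= d < M.+1) (8 / y) * (d%:R^-1 * invroot R 3 d)) _.
  apply: ler_sum_nat => d /andP[d0 _]; rewrite -mulr_sumr.
  have dR : 0 < d%:R :> R by rewrite ltr0n.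
  have tail : \sum_(1 <= k < M.+1 | (y < k%:R) && (d %| k)%N) (k%:R ^+ 2)^-1
      <= 2 / y / d%:R :> R.
    apply: le_trans (ler_sum_multiples _ _ d0 _) _.
      by move=> n; rewrite invr_ge0 exprn_ge0.
    under eq_bigl do rewrite natrM mulrC -ltr_pdivrMr//.
    under eq_bigr do rewrite natrM exprMn invfM.
    rewrite -mulr_sumr.
    apply: le_trans (ler_wpM2l _ (sum_sqr_tail_le M (divr_gt0 y0 dR))) _.
      by rewrite invr_ge0 exprn_ge0.
    rewrite le_eqVlt; apply/orP; left; apply/eqP; field.
    by rewrite !gt_eqF.
  apply: le_trans (ler_pM _ _ (inv_totient_le R d0) tail) _.
  - by rewrite invr_ge0.
  - by apply: sumr_ge0 => n _; rewrite invr_ge0 exprn_ge0.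
  rewrite le_eqVlt; apply/orP; left; apply/eqP; field.
  by rewrite !gt_eqF.
rewrite -mulr_sumr.
apply: le_trans (ler_wpM2l _ (sum_invroot_le R M (isT : 0 < 3)%N)) _.
  by rewrite divr_ge0// ltW.
rewrite le_eqVlt; apply/orP; left; apply/eqP; field.
by rewrite gt_eqF.
Qed.

Lemma sum_gcd_tail (R : realType) (M N : nat) (x : R) : (0 < N)%N -> 0 < x ->
  \sum_(1 <= m < M.+1 | x < m%:R) (gcdn m N)%:R / (m%:R * (totient m)%:R)
  <= 48 / x * (size (divisors N))%:R.
Proof.
move=> N0 x0; under eq_bigr do rewrite gcdn_sum_totient// mulr_suml.
rewrite (exchange_big_dep xpredT)//=.
(* The right side becomes the constant 48 / x summed over the divisors of N, for a termwise
   comparison. *)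
rewrite mulr_natr -iter_addr_0 -count_predT -big_const_seq.
rewrite big_seq [leRHS]big_seq; apply: ler_sum => d.
rewrite -dvdn_divisors// => dN; have d0 := dvdn_gt0 N0 dN.
have dR : 0 < d%:R :> R by rewrite ltr0n.
have td : 0 < (totient d)%:R :> R by rewrite ltr0n totient_gt0.
under eq_bigl do rewrite dvdn_gcd dN andbT.
rewrite -mulr_sumr.
apply: le_trans (ler_wpM2l (ltW td) (ler_sum_multiples _ _ d0 _)) _.
  by move=> n; rewrite invr_ge0 mulr_ge0.
(* Here m = d j with j > x / d. The factors phi(d) cancel, and 1 / d cancels the d in the tail bound
   48 d / x, which makes the estimate uniform in d. *)
apply: le_trans (_ : _ <= (totient d)%:R * ((d%:R * (totient d)%:R)^-1 *
    \sum_(1 <= j < M.+1 | x / d%:R < j%:R) (j%:R * (totient j)%:R)^-1)) _.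
  rewrite ler_wpM2l ?(ltW td)// mulr_sumr.
  under eq_bigl do rewrite natrM mulrC -ltr_pdivrMr//.
  rewrite big_nat_cond [leRHS]big_nat_cond; apply: ler_sum => j /andP[/andP[j0 _] _].
  rewrite -invfM lef_pV2 ?posrE ?mulr_gt0 ?ltr0n ?totient_gt0 ?muln_gt0 ?d0//.
  rewrite mulrACA -!natrM ler_nat leq_mul//; exact: totient_supermul.
rewrite mulrA.
apply: le_trans (ler_wpM2l _ (sum_inv_mul_totient_tail M (divr_gt0 x0 dR))) _.
  by rewrite mulr_ge0 ?invr_ge0 ?mulr_ge0.
rewrite le_eqVlt; apply/orP; left; apply/eqP; field.
by rewrite !gt_eqF.
Qed.

(** * The sum over the remaining variables *)

(** In sixth powers, tau(N)^6 <= 64 N^3 and N^4 <= 64^2 phi(N)^6 bound the ratio by 64^3 / N = 8^6 /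
    N. The parameter k splits N^(-1/6) into k equal factors. *)
Lemma divisors_totient_ratio_le (R : realType) (k N : nat) : (0 < k)%N -> (0 < N)%N ->
  (size (divisors N))%:R / (totient N)%:R <= 8 * invroot R (k * 6) N ^+ k.
Proof.
move=> k0 N0; have t0 : (0 < totient N)%N by rewrite totient_gt0.
rewrite -(ler_pXn2r (isT : 0 < 6)%N) ?nnegrE ?mulr_ge0 ?invr_ge0 ?exprn_ge0 ?powR_ge0//.
rewrite !exprMn -exprM invroot_expr ?muln_gt0 ?k0// exprVn.
rewrite ler_pdivlMr ?ltr0n// mulrAC ler_pdivrMr ?exprn_gt0 ?ltr0n//.
have tau : (size (divisors N))%:R ^+ 2 <= 4 * N%:R :> R.
  by rewrite -natrX -natrM ler_nat size_divisors_sq_le.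
have phi : N%:R ^+ 2 <= 64 * (totient N)%:R ^+ 3 :> R.
  by rewrite -!natrX -natrM ler_nat totient_cube_ge.
apply: le_trans (_ : _ <= (4 * N%:R) ^+ 3 * N%:R) _.
  by rewrite ler_wpM2r// (exprM _ 2 3) lerXn2r// nnegrE ?exprn_ge0 ?mulr_ge0.
rewrite [leLHS](_ : _ = 64 * (N%:R ^+ 2) ^+ 2); last by ring.
rewrite [leRHS](_ : _ = 64 * (64 * (totient N)%:R ^+ 3) ^+ 2); last by ring.
by rewrite ler_wpM2l// lerXn2r// nnegrE ?mulr_ge0 ?exprn_ge0.
Qed.

Lemma sum_inv_mul_invroot_le (R : realType) (s M k : nat) : (0 < k)%N ->
  \sum_(h : {ffun 'I_s -> 'I_M}) \prod_(i < s) ((h i).+1%:R^-1 * invroot R k (h i).+1)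
  <= (2 * k%:R) ^+ s.
Proof.
move=> k0; rewrite -(bigA_distr_bigA (fun (_ : 'I_s) (j : 'I_M) =>
  j.+1%:R^-1 * invroot R k j.+1)) -[s in leRHS]card_ord -prodr_const.
apply: ler_prod => i _; rewrite sumr_ge0 /=; last first.
  by move=> j _; rewrite mulr_ge0 ?invr_ge0 ?powR_ge0.
have := sum_invroot_le R M k0.
by rewrite big_add1 big_mkord.
Qed.

Lemma inv_totient_lcm_le (R : numFieldType) (m n : nat) : (0 < m)%N -> (0 < n)%N ->
  (totient (lcmn m n))%:R^-1 <=
  (gcdn m n)%:R / ((totient m)%:R * (totient n)%:R) :> R.
Proof.
move=> m0 n0.
rewrite ler_pdivlMr ?mulr_gt0 ?ltr0n ?totient_gt0// mulrC.
rewrite ler_pdivrMr ?ltr0n ?totient_gt0 ?lcmn_gt0 ?m0// -!natrM ler_nat.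
exact: totient_mul_le_gcd_lcm.
Qed.

Lemma lcm_succ_gt0 (s : nat) (h : 'I_s -> nat) :
  (0 < \big[lcmn/1%N]_(i < s) (h i).+1)%N.
Proof. by elim/big_ind: _ => // a b a0 b0; rewrite lcmn_gt0 a0. Qed.

Lemma divisors_totient_lcm_le (R : realType) (s : nat) (h : 'I_s -> nat) (N : nat) :
  N = (\big[lcmn/1%N]_(i < s) (h i).+1)%N ->
  (size (divisors N))%:R / (totient N)%:R <=
  8 * \prod_(i < s) invroot R (s.+1 * 6) (h i).+1.
Proof.
move=> NE; have N0 : (0 < N)%N by rewrite NE lcm_succ_gt0.
apply: le_trans (divisors_totient_ratio_le R (ltn0Sn s) N0) _.
rewrite ler_wpM2l//.
(* Of the s + 1 equal factors one is at most 1 and is discarded; the others are assigned to the s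
   entries, each of which divides N. Splitting into s + 1 keeps the root index positive when s =
   0. *)
apply: le_trans (_ : _ <= invroot R (s.+1 * 6) N ^+ s) _.
  by rewrite exprS ler_piMl ?exprn_ge0 ?powR_ge0 ?invroot_le1.
rewrite -[s in _ ^+ s]card_ord -prodr_const; apply: ler_prod => i _.
rewrite powR_ge0 /= invroot_le// dvdn_leq//.
by rewrite NE (bigD1 i)//= dvdn_lcml.
Qed.

(** * Sums over finite boxes and the conclusion *)

Definition ffun_cons (T : Type) (s : nat) (u : T * {ffun 'I_s -> T}) :
    {ffun 'I_s.+1 -> T} :=
  [ffun i => if unlift ord0 i is Some j then u.2 j else u.1].

Lemma ffun_cons_bij (T : Type) (s : nat) : bijective (@ffun_cons T s).
Proof.
exists (fun f : {ffun 'I_s.+1 -> T} =>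
  (f ord0, [ffun j : 'I_s => f (lift ord0 j)])) => [[a h]|f].
  rewrite !ffunE unlift_none; congr pair.
  by apply/ffunP => j; rewrite !ffunE liftK.
by apply/ffunP => i; rewrite !ffunE; case: unliftP => [j|] ->; rewrite ?ffunE.
Qed.

(** Indices are shifted by one, so the entries run from 1 to M. The first entry is summed first with
    the others fixed: it gives 48 tau(N) / x, the ratio tau(N) / phi(N) gives 8, and 384 = 48 * 8.
    Each of the s other entries then contributes a factor 2 * 6 (s + 1). *)
Lemma box_sum_le (R : realType) (s M : nat) (x : R) : 0 < x ->
  \sum_(g : {ffun 'I_s.+1 -> 'I_M} | x < (g ord0).+1%:R)
     summand R [ffun i => (g i).+1]
  <= 384 * (2 * (s.+1 * 6)%:R) ^+ s / x.
Proof.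
move=> x0; rewrite (reindex _ (onW_bij _ (ffun_cons_bij _ _))) /=.
under eq_bigl do rewrite ffunE unlift_none /=.
rewrite [leLHS](_ : _ = \sum_(h : {ffun 'I_s -> 'I_M}) \sum_(a < M | x < a.+1%:R)
    summand R [ffun i => (ffun_cons (a, h) i).+1]); last first.
  rewrite [RHS](exchange_big_dep (fun a : 'I_M => x < a.+1%:R))//= pair_big_dep.
  by apply: eq_big => [[a h]|[a h] _] //=; rewrite andbb.
apply: le_trans (_ : _ <= \sum_(h : {ffun 'I_s -> 'I_M}) 384 / x *
    \prod_(i < s) ((h i).+1%:R^-1 * invroot R (s.+1 * 6) (h i).+1)) _; last first.
  rewrite -mulr_sumr [leRHS]mulrAC ler_wpM2l ?divr_ge0 ?(ltW x0)//.
  exact: sum_inv_mul_invroot_le.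
apply: ler_sum => h _.
pose N := (\big[lcmn/1%N]_(i < s) (h i).+1)%N.
have N0 : (0 < N)%N by apply: (lcm_succ_gt0 (fun i => h i)).
pose P : R := \prod_(i < s) (h i).+1%:R.
have P0 : 0 <= P by apply: prodr_ge0 => i _; rewrite ler0n.
have tN : 0 < (totient N)%:R :> R by rewrite ltr0n totient_gt0.
apply: le_trans (_ : _ <= \sum_(i < M | x < i.+1%:R)
   ((gcdn i.+1 N)%:R / (i.+1%:R * (totient i.+1)%:R)) * ((totient N)%:R * P)^-1) _.
  apply: ler_sum => a _.
  have -> : summand R [ffun i => (ffun_cons (a, h) i).+1] =
      (totient (lcmn a.+1 N))%:R^-1 * (a.+1%:R * P)^-1.
    rewrite /summand /lcm_fam !big_ord_recl !ffunE unlift_none /= invfM.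
    congr ((totient (lcmn _ _))%:R^-1 * (_ * _)^-1).
      by apply: eq_bigr => i _; rewrite !ffunE liftK.
    by apply: eq_bigr => i _; rewrite !ffunE liftK.
  apply: le_trans (ler_wpM2r _ (inv_totient_lcm_le R (ltn0Sn a) N0)) _.
    by rewrite invr_ge0 mulr_ge0.
  by rewrite -!mulrA -!invfM !mulrA le_eqVlt; apply/orP; left; apply/eqP; congr (_ / _); ring.
rewrite -mulr_suml.
have := sum_gcd_tail M N0 x0; rewrite big_add1 big_mkord => /= gcd_le.
apply: le_trans (ler_wpM2r _ gcd_le) _.
  by rewrite invr_ge0 mulr_ge0 ?(ltW tN).
rewrite [leLHS](_ : _ = 48 / x * ((size (divisors N))%:R / (totient N)%:R / P)); last first.
  by rewrite invfM !mulrA.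
apply: le_trans (ler_wpM2l _ (ler_wpM2r _ (divisors_totient_lcm_le R (h := fun i => h i) (erefl N)))) _.
- by rewrite divr_ge0 ?(ltW x0).
- by rewrite invr_ge0.
rewrite big_split /= prodfV -/P.
by rewrite le_eqVlt; apply/orP; left; apply/eqP; ring.
Qed.

Theorem theorem2p1 (R : realType) (r : nat) (hr : (0 < r)%N) :
  exists C : R, forall x : R, 1 <= x ->
    (\esum_(n in tail_tuples hr x) (summand R n)%:E <= (C / x)%:E)%E.
Proof.
case: r hr => // s hr.
exists (384 * (2 * (s.+1 * 6)%:R) ^+ s) => x x1.
have x0 : 0 < x by apply: lt_le_trans x1.
have summand_ge0 (n : {ffun 'I_s.+1 -> nat}) : 0 <= summand R n.
  by rewrite invr_ge0 mulr_ge0// prodr_ge0.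
(* The infinite sum is the supremum of the sums over finite subsets, so a uniform bound on these
   suffices. *)
apply: ub_ereal_sup => _ [A [finA subA] <-].
rewrite fsbig_finite// sumEFin lee_fin.
pose M := (\max_(n <- fset_set A) \max_(i < s.+1) n i)%N.
have memA n : n \in fset_set A -> tail_tuples hr x n.
  by rewrite in_fset_set// => /set_mem/subA.
apply: le_trans (box_sum_le s M.+1 x0).
rewrite -[leRHS]big_filter.
have leM n i : n \in fset_set A -> ((n i).-1 < M.+1)%N.
  move=> nA; rewrite ltnS (leq_trans (leq_pred _))//.
  apply: leq_trans (_ : \max_(i < s.+1) n i <= _)%N; first exact: leq_bigmax.
  exact: (leq_bigmax_seq (P := xpredT)
    (F := fun n : {ffun 'I_s.+1 -> nat} => \max_(i < s.+1) n i)%N).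
(* On [A] all entries are positive and at most [M], so their predecessors lie below [M.+1]. There
   [inord] never takes its default value, and [h] is inverted by adding one. *)
pose h (n : {ffun 'I_s.+1 -> nat}) : {ffun 'I_s.+1 -> 'I_M.+1} :=
  [ffun i => inord (n i).-1].
have hK n : n \in fset_set A -> [ffun i => (h n i).+1] = n.
  move=> nA; apply/ffunP => i; rewrite !ffunE inordK ?leM// prednK//.
  by case: (memA _ nA) => + _; apply.
apply: (ler_sum_inj (h := h)).
- exact: fset_uniq.
- by rewrite filter_uniq// index_enum_uniq.
- by move=> m n mA nA hmn; rewrite -(hK m)// -(hK n)// hmn.
- move=> n nA; rewrite mem_filter mem_index_enum andbT.
  have [_] := memA _ nA; rewrite -{1}(hK n nA) ffunE.
  by rewrite (_ : Ordinal hr = ord0)//; apply: val_inj.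
- by move=> n nA; rewrite hK.
- by [].
Qed.
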